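(* In the setting of the context, there is a constant $j_*$ depending only on the geometric data (including the chosen $x_{\{i,k\}}$) such that for every supersymmetric configuration with $j_I\ge j_*$ for all $I=0,\dots,p$, $$n_0^{D5}\le\tfrac12\max(x_{\{i,k\}})\cdot\min(T_i)\cdot\max(T_i)+T_0,$$ where the maximum of $x_{\{i,k\}}$ is over all pairs of distinct indices in $\{1,\dots,p\}$ and the minimum and maximum of $T_i$ are over $i\in\{1,\dots,p\}$.
   Context: Geometry. $B$ is a smooth projective complex surface, $\pi:X\to B$ is a smooth elliptically fibered Calabi--Yau threefold with a single section $\sigma$, so $\sigma^2=-c_1\sigma$ and $H^{1,1}(X)$ is spanned by $\sigma$ and $\pi^*H^{1,1}(B)$; $c_1,c_2$ are the Chern classes of $B$. Let $D_1,\dots,D_p\in H^2(B,\mathbb{Z})$, $p=h^{1,1}(B)\ge2$, be linearly independent classes generating the Kähler cone of $B$ or a simplicial subcone; their pullbacks to $X$ are denoted by the same symbols, and $D_0=\sigma+\pi^*c_1$. Let $C$ be the intersection form on $H^{1,1}(B)$, $C_{ij}=D_i\cdot D_j$. Write $c_1=\sum_i b_iD_i$, $b=(b_i)$, $\mathcal K_{00i}=\sum_j b_jC_{ij}$, $\mathcal K_{000}=\sum_{i,j} b_ib_jC_{ij}$. The triple intersection form $\mathcal K$ on $X$ is the symmetric trilinear form with $\mathcal K(D_i,D_j,D_k)=0$, $\mathcal K(D_0,D_i,D_j)=C_{ij}$, $\mathcal K(D_0,D_0,D_i)=\mathcal K_{00i}$, $\mathcal K(D_0,D_0,D_0)=\mathcal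 K_{000}$. Put $T_0=\int_B(c_2+11c_1^2)$ and $T_i=12\,\mathcal K_{00i}$. Assume: (1) all $D_i$ are time-like or light-like for $C$ ($C(D_i,D_i)\ge0$) and lie in the same closed light-cone; (2) $b_i\ge 0$ for all $i$; (3) every $\mathcal K_{00i}$ is a positive integer; (4) $C$ has signature $(1,p-1)$. For each pair $\{i,k\}$, $i\ne k$, fix a positive rational number $x_{\{i,k\}}$ such that the matrix $(M_{\{i,k\}})_{jl}=x_{\{i,k\}}C_{ij}C_{kl}+x_{\{i,k\}}C_{il}C_{kj}-C_{jl}$ is positive semi-definite (such numbers exist under (1), (4)). Supersymmetric configuration: a finite collection of D9-brane stacks $\alpha$, each with a positive integer $N^\alpha$ and a flux $F^\alpha=m_0^\alpha D_0+\sum_{i}m_i^\alpha D_i\in H^2(X,\mathbb{Z})$ ($m_I^\alpha\in\mathbb{Q}$, $m_0^\alpha\in\mathbb{Z}$, $\sum_jC_{ij}m_j^\alpha\in\mathbb{Z}$), non-negative integers $n^{D5}_0,\dots,n^{D5}_p$ (numbers of D5-branes), and a real Kähler class $J=j_0D_0+\sum_ij_iD_i$ with $j_I>0$, such that: $n^{D5}_I-T_I=\sum_\alpha N^\alpha\mathcal K(F^\alpha,F^\alpha,D_I)$ for $I=0,\dots,p$; $\sum_\alpha N^\alpha=16$; and for each $\alpha$, $3\mathcal K(J,J,F^\alpha)=\mathcal K(F^\alpha,F^\alpha,F^\alpha)$ and $\mathcal K(J,J,J)>3\mathcal K(J,F^\alpha,F^\alpha)$. *)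

(* Defs.v *)
From HB Require Import structures.
From mathcomp Require Import all_boot all_order all_algebra.
From mathcomp Require Import reals.

Set Implicit Arguments.
Unset Strict Implicit.
Unset Printing Implicit Defensive.

Import Order.TTheory GRing.Theory Num.Theory.
Local Open Scope ring_scope.

(* [A] is the Gram matrix of a real symmetric bilinear form. *)
Definition bilin (R : realType) (n : nat) (A : 'M[R]_n) (u v : 'rV[R]_n) : R :=
  (u *m A *m v^T) 0 0.

Definition possemidef (R : realType) (n : nat) (A : 'M[R]_n) : Prop :=
  A^T = A /\ forall u : 'rV[R]_n, 0 <= bilin A u u.

(* Some diagonalization of the form by a real change of basis has r positive
   and s negative diagonal entries, and no zero ones when r + s = n. *)
Definition has_signature (R : realType) (n : nat) (A : 'M[R]_n) (r s : nat) :
    Prop :=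
  exists (P : 'M[R]_n) (d : 'rV[R]_n),
    [/\ P \in unitmx, P *m A *m P^T = diag_mx d,
        #|[set i | 0 < d 0 i]| = r & #|[set i | d 0 i < 0]| = s].

(* For a Lorentzian form and a time-like [t], the closed light-cone (one of the
   two halves of the set of time-like and light-like vectors) containing [t]. *)
Definition closed_light_cone (R : realType) (n : nat) (A : 'M[R]_n)
    (t v : 'rV[R]_n) : Prop :=
  0 <= bilin A v v /\ 0 <= bilin A t v.

(* The intersection numbers of the elliptically fibered threefold, in the basis
   D_1, ..., D_p of H^{1,1}(B), p = h^{1,1}(B).  The D_i are integral classes,
   so C is integral; c_1 is integral too, hence a rational combination of the
   D_i (these need not generate H^2(B,Z)). *)
Record geometry (p : nat) := Geometry {
  geoC : 'M[int]_p;                  (* C_ij = D_i . D_j *)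
  geob : 'rV[rat]_p;                 (* c_1 = \sum_i b_i D_i *)
  geoc2 : int;                       (* \int_B c_2 *)
  geox : {set 'I_p} -> rat           (* x_{i,k}; used on pairs [set i; k] only *)
}.

Definition Cmat (R : realType) (p : nat) (G : geometry p) : 'M[R]_p :=
  map_mx intr (geoC G).

Definition bvec (R : realType) (p : nat) (G : geometry p) : 'rV[R]_p :=
  map_mx ratr (geob G).

Definition xpair (R : realType) (p : nat) (G : geometry p) (i k : 'I_p) : R :=
  ratr (geox G [set i; k]).

Definition K00 (R : realType) (p : nat) (G : geometry p) (i : 'I_p) : R :=
  \sum_j bvec R G 0 j * Cmat R G i j.

(* K000 is also \int_B c_1^2. *)
Definition K000 (R : realType) (p : nat) (G : geometry p) : R :=
  \sum_i \sum_j bvec R G 0 i * bvec R G 0 j * Cmat R G i j.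

(* On the threefold X, the index ord0 : 'I_p.+1 stands for D_0 and
   lift ord0 i for (the pullback of) D_i; unlift ord0 separates the two cases.
   Elements of H^{1,1}(X) are row vectors of coordinates on D_0, ..., D_p. *)
Definition Kcoef (R : realType) (p : nat) (G : geometry p)
    (I J L : 'I_p.+1) : R :=
  match unlift ord0 I, unlift ord0 J, unlift ord0 L with
  | None, None, None => K000 R G
  | Some i, None, None | None, Some i, None | None, None, Some i => K00 R G i
  | None, Some i, Some j | Some i, None, Some j | Some i, Some j, None =>
      Cmat R G i j
  | Some _, Some _, Some _ => 0
  end.

Definition Kform (R : realType) (p : nat) (G : geometry p)
    (u v w : 'rV[R]_p.+1) : R :=
  \sum_I \sum_J \sum_L u 0 I * v 0 J * w 0 L * Kcoef R G I J L.

Definition Dclass (R : realType) (p : nat) (I : 'I_p.+1) : 'rV[R]_p.+1 :=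
  delta_mx 0 I.

Definition T0 (R : realType) (p : nat) (G : geometry p) : R :=
  (geoc2 G)%:~R + 11 * K000 R G.

Definition Tbase (R : realType) (p : nat) (G : geometry p) (i : 'I_p) : R :=
  12 * K00 R G i.

Definition Ttad (R : realType) (p : nat) (G : geometry p) (I : 'I_p.+1) : R :=
  if unlift ord0 I is Some i then Tbase R G i else T0 R G.

Definition Mmat (R : realType) (p : nat) (G : geometry p) (i k : 'I_p) :
    'M[R]_p :=
  \matrix_(j, l) (xpair R G i k * Cmat R G i j * Cmat R G k l
                  + xpair R G i k * Cmat R G i l * Cmat R G k j - Cmat R G j l).

Record admissible (R : realType) (p : nat) (G : geometry p) : Prop := {
  adm_sym : (Cmat R G)^T = Cmat R G;
  adm_cone : exists t : 'rV[R]_p, 0 < bilin (Cmat R G) t t /\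
    forall i : 'I_p, closed_light_cone (Cmat R G) t (delta_mx 0 i);
  adm_b : forall i : 'I_p, 0 <= bvec R G 0 i;
  adm_K00 : forall i : 'I_p, K00 R G i \is a Num.int /\ 0 < K00 R G i;
  adm_sign : has_signature (Cmat R G) 1 p.-1;
  adm_x : forall i k : 'I_p, i != k ->
    0 < xpair R G i k /\ possemidef (Mmat R G i k)
}.

Record configuration (R : realType) (p : nat) := Configuration {
  nstacks : nat;
  mult : 'I_nstacks -> nat;                  (* N^alpha *)
  fluxQ : 'I_nstacks -> 'rV[rat]_p.+1;       (* coordinates m_I^alpha *)
  nD5 : 'I_p.+1 -> nat;
  kahler : 'rV[R]_p.+1                       (* coordinates j_I of J *)
}.

Definition flux (R : realType) (p : nat) (cfg : configuration R p)
    (al : 'I_(nstacks cfg)) : 'rV[R]_p.+1 :=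
  map_mx ratr (fluxQ al).

Record supersymmetric (R : realType) (p : nat) (G : geometry p)
    (cfg : configuration R p) : Prop := {
  susy_mult : forall al : 'I_(nstacks cfg), (0 < mult al)%N;
  susy_int0 : forall al : 'I_(nstacks cfg), fluxQ al 0 ord0 \is a Num.int;
  susy_int : forall (al : 'I_(nstacks cfg)) (i : 'I_p),
    \sum_(j < p) (geoC G i j)%:~R * fluxQ al 0 (lift ord0 j) \is a Num.int;
  susy_J : forall I : 'I_p.+1, 0 < kahler cfg 0 I;
  susy_tadpole : forall I : 'I_p.+1,
    (nD5 cfg I)%:R - Ttad R G I =
      \sum_(al < nstacks cfg)
         (mult al)%:R * Kform G (flux al) (flux al) (Dclass R I);
  susy_D9 : (\sum_(al < nstacks cfg) mult al = 16)%N;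
  susy_phase : forall al : 'I_(nstacks cfg),
    3 * Kform G (kahler cfg) (kahler cfg) (flux al) =
      Kform G (flux al) (flux al) (flux al);
  susy_pos : forall al : 'I_(nstacks cfg),
    3 * Kform G (kahler cfg) (flux al) (flux al) <
      Kform G (kahler cfg) (kahler cfg) (kahler cfg)
}.

(* The neutral element 0 does not affect the two maxima, which are taken over
   nonempty families (p >= 2) of positive numbers. *)
Definition max_x (R : realType) (p : nat) (G : geometry p) : R :=
  \big[Num.max/0]_(ik : 'I_p * 'I_p | ik.1 != ik.2) xpair R G ik.1 ik.2.

Definition max_T (R : realType) (p : nat) (G : geometry p) : R :=
  \big[Num.max/0]_(i < p) Tbase R G i.

Definition min_T (R : realType) (p : nat) (G : geometry p) : R :=
  \big[Num.min/max_T R G]_(i < p) Tbase R G i.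

(* Main.v *)
Require Import Defs.
From mathcomp Require Import all_boot all_order all_algebra.
From mathcomp Require Import reals.
From mathcomp Require Import zify ring lra.
Import Order.TTheory GRing.Theory Num.Theory.
Local Open Scope ring_scope.

Set Implicit Arguments.
Unset Strict Implicit.
Unset Printing Implicit Defensive.

(* Write a flux as [F = m_0 (sigma + c_1 / 2) + U] with [U] a class on the base,
   let [g] be the base class obtained from [J] in the same way, and rescale [U]
   to [y = - 2 U / m_0] when [m_0 <> 0].  The phase condition says that
   [j_0 g.y] differs from a constant common to all stacks only by
   [m_0^2 (y.y / 4 + c_1.c_1 / 12)].  For large [J] the tadpoles of the [D_i]
   bound [m_0^2], and the vectors [y] nearly lie on one hyperplane orthogonal to
   the time-like [g], on which the form is negative definite.  Hence the weighted
   sum of the squares of the [y - c_1], which is four times the [D_0]-tadpole, is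
   up to a small error at most [V.V / mu], where [V] is the weighted sum of the
   [y - c_1] and [mu] the total weight.  The tadpoles bound the coordinates
   [V_i = V.D_i] from above, and positivity of [M_{i,k}] is
   [V.V <= 2 x_{i,k} V_i V_k].  If all [V_i >= 0] this is the claim; otherwise
   integrality of the [V_i] makes [V] so space-like that [V.V] absorbs the error.
   Stacks with [m_0 = 0] contribute nonpositively, by the phase condition. *)

(** * Bilinear forms and the reverse Cauchy-Schwarz inequality *)

Section Bilin.
Variables (R : realType) (n : nat) (A : 'M[R]_n).
Implicit Types u v w : 'rV[R]_n.

Lemma bilinE u v : bilin A u v = \sum_i \sum_j u 0 i * A i j * v 0 j.
Proof.
rewrite /bilin mxE exchange_big /=; apply: eq_bigr => j _.
by rewrite !mxE mulr_suml.
Qed.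

Lemma bilinDl u v w : bilin A (u + v) w = bilin A u w + bilin A v w.
Proof. by rewrite /bilin !mulmxDl mxE. Qed.

Lemma bilinDr u v w : bilin A u (v + w) = bilin A u v + bilin A u w.
Proof. by rewrite /bilin linearD mulmxDr mxE. Qed.

Lemma bilinZl a u v : bilin A (a *: u) v = a * bilin A u v.
Proof. by rewrite /bilin -!scalemxAl mxE. Qed.

Lemma bilinZr a u v : bilin A u (a *: v) = a * bilin A u v.
Proof. by rewrite /bilin linearZ -scalemxAr mxE. Qed.

Lemma bilinNl u v : bilin A (- u) v = - bilin A u v.
Proof. by rewrite -scaleN1r bilinZl mulN1r. Qed.

Lemma bilinNr u v : bilin A u (- v) = - bilin A u v.
Proof. by rewrite -scaleN1r bilinZr mulN1r. Qed.

Lemma bilin0r u : bilin A u 0 = 0.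
Proof. by rewrite -[0](scale0r 0) bilinZr mul0r. Qed.

Lemma bilin_sumr (I : finType) (P : pred I) (a : I -> R) (v : I -> 'rV[R]_n) u :
  bilin A u (\sum_(i | P i) a i *: v i) = \sum_(i | P i) a i * bilin A u (v i).
Proof.
rewrite (big_morph _ (bilinDr u) (bilin0r u)).
by apply: eq_bigr => i _; rewrite bilinZr.
Qed.

Hypothesis symA : A^T = A.

Lemma bilinC u v : bilin A u v = bilin A v u.
Proof.
have -> : bilin A v u = (v *m A *m u^T)^T 0 0 by rewrite mxE.
by rewrite !trmx_mul trmxK symA mulmxA.
Qed.

Definition reverse_CS :=
  forall a x, 0 < bilin A a a -> bilin A a a * bilin A x x <= bilin A a x ^+ 2.

(** Subtracting from [x] the multiple of [a] that cancels its coordinate along the only positive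
    diagonal direction leaves a vector of nonpositive square. Expanding that square gives the
    inequality. *)
Lemma signature_reverse_CS s : has_signature A 1 s -> s.+1 = n -> reverse_CS.
Proof.
move=> [P [d [Pu PAP /eqP/cards1P [i0 d0] dneg]]] sn a x aa.
have dle i : i != i0 -> d 0 i <= 0.
  move=> ii0; rewrite leNgt; apply/negP => dp.
  have : i \in [set i | 0 < d 0 i] by rewrite inE.
  by rewrite d0 inE (negbTE ii0).
pose c (u : 'rV[R]_n) := u *m invmx P.
have cK u : c u *m P = u by rewrite /c mulmxKV.
have bE u v : bilin A u v = \sum_i d 0 i * c u 0 i * c v 0 i.
  rewrite -{1}(cK u) -{1}(cK v) /bilin trmx_mul !mulmxA.
  rewrite -(mulmxA _ P A) -(mulmxA _ (P *m A)) PAP mxE.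
  by apply: eq_bigr => i _; rewrite mul_mx_diag !mxE; ring.
have neg u : c u 0 i0 = 0 -> bilin A u u <= 0.
  move=> u0; rewrite bE sumr_le0 // => i _.
  have [->|/dle di] := eqVneq i i0; first by rewrite u0 mulr0.
  by rewrite -mulrA mulr_le0_ge0 // -expr2 sqr_ge0.
have a0 : c a 0 i0 != 0.
  by apply/eqP => /neg; rewrite leNgt aa.
pose r := c x 0 i0 / c a 0 i0.
have /neg : c (x - r *: a) 0 i0 = 0.
  rewrite {1}/c mulmxBl -scalemxAl -/(c x) -/(c a) /r.
  by move: (c x) (c a) a0 => u v v0; rewrite !mxE divfK // subrr.
rewrite !(bilinDl, bilinDr, bilinNl, bilinNr, bilinZl, bilinZr) (bilinC x a).
move: (bilin A a a) (bilin A a x) (bilin A x x) aa => p q t p0 h.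
have := mulr_ge0_le0 (ltW p0) h.
have := sqr_ge0 (q - r * p).
by move=> h1 h2; lra.
Qed.

End Bilin.

(** For [a > 0] the quadratic is evaluated at its minimum [- b / a]. For [a = 0] a nonzero [b] is
    excluded by a point where the affine function equals [-1]. *)
Lemma discriminant_le (R : realFieldType) (a b c : R) : 0 <= a ->
  (forall t, 0 <= a * t ^+ 2 + 2 * b * t + c) -> b ^+ 2 <= a * c.
Proof.
rewrite le_eqVlt => /predU1P[<-|a0] h.
  have [->|b0] := eqVneq b 0; first by rewrite expr0n mul0r.
  have := h (- (c + 1) / (2 * b)).
  have -> : 0 * (- (c + 1) / (2 * b)) ^+ 2 + 2 * b * (- (c + 1) / (2 * b)) + c
     = -1 by field.
  by rewrite oppr_ge0 ler10.
have /= := h (- b / a).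
have -> : a * (- b / a) ^+ 2 + 2 * b * (- b / a) + c = (a * c - b ^+ 2) / a.
  by field; rewrite gt_eqF.
by rewrite pmulr_lge0 ?invr_gt0 // subr_ge0.
Qed.

(** * Lorentzian geometry: light-cones and the Wick-rotated norm *)

Section Lorentz.
Variables (R : realType) (n : nat) (A : 'M[R]_n).
Implicit Types u v w x y : 'rV[R]_n.
Hypothesis symA : A^T = A.
Hypothesis lorA : reverse_CS A.
Notation "u '|*|' v" := (bilin A u v) (at level 39).

Let bE := (bilinDl, bilinDr, bilinNl, bilinNr, bilinZl, bilinZr).

Lemma closed_light_cone_bilin_ge0 t x y : 0 < t |*| t ->
  closed_light_cone A t x -> closed_light_cone A t y -> 0 <= x |*| y.
Proof.
move=> t0 [xx tx] [yy ty].
(* A vector of nonnegative square orthogonal to [t] is null and lies in the radical: reverse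
   Cauchy-Schwarz for [v - s *: u] is affine in [s], so its slope vanishes. *)
have perp u v : t |*| u = 0 -> 0 <= u |*| u -> u |*| v = 0.
  move=> tu uu.
  have uu0 : u |*| u = 0.
    apply/eqP; rewrite eq_le uu andbT.
    by rewrite -(pmulr_rle0 _ t0); have := lorA u t0; rewrite tu expr0n.
  have : (u |*| v) ^+ 2 <= 0 * ((t |*| v) ^+ 2 / (t |*| t) - v |*| v).
    apply: discriminant_le => // s.
    have := lorA (v - s *: u) t0.
    rewrite !bE tu uu0 (bilinC symA v u).
    move: (t |*| t) (t |*| v) (v |*| v) (u |*| v) t0 => p q r k p0 h.
    have : (r - 2 * s * k) <= q ^+ 2 / p.
      by rewrite ler_pdivlMr //; lra.
    by move=> h'; lra.
  rewrite mul0r => h; apply/eqP; rewrite -sqrf_eq0 eq_le h; exact: sqr_ge0.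
have [tx0|txn] := eqVneq (t |*| x) 0; first by rewrite perp.
have [ty0|tyn] := eqVneq (t |*| y) 0; first by rewrite (bilinC symA) perp.
have tx1 : 0 < t |*| x by rewrite lt_neqAle eq_sym txn.
have ty1 : 0 < t |*| y by rewrite lt_neqAle eq_sym tyn.
(* This combination is orthogonal to [t], so its square is nonpositive; the cross term [x.y] must
   outweigh the two nonnegative squares. *)
have := lorA ((t |*| y) *: x - (t |*| x) *: y) t0.
rewrite !bE (bilinC symA y x).
have -> : t |*| y * t |*| x - t |*| x * t |*| y = 0 by ring.
rewrite expr0n /= pmulr_rle0 // => h.
rewrite -(pmulr_rge0 _ (mulr_gt0 tx1 ty1)).
have := mulr_ge0 (sqr_ge0 (t |*| y)) xx.
have := mulr_ge0 (sqr_ge0 (t |*| x)) yy.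
by move=> h1 h2; lra.
Qed.

(* The positive definite form obtained by reversing the sign of the Lorentzian
   form on the orthogonal of the time-like vector [g]. *)
Definition wick g x := 2 * (g |*| x) ^+ 2 / (g |*| g) - x |*| x.

Variable g : 'rV[R]_n.
Hypothesis gg0 : 0 < g |*| g.

Lemma sqr_bilin_ge x : x |*| x <= (g |*| x) ^+ 2 / (g |*| g).
Proof. by rewrite ler_pdivlMr // mulrC lorA. Qed.

Lemma wick_ge0 x : 0 <= wick g x.
Proof.
rewrite /wick subr_ge0 (le_trans (sqr_bilin_ge x)) // ler_pM2r ?invr_gt0 //.
by rewrite ler_peMl ?sqr_ge0 // ler1n.
Qed.

Lemma bilin_le_wick x : x |*| x <= wick g x.
Proof. by rewrite /wick; have := sqr_bilin_ge x; lra. Qed.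

Lemma norm_bilin_le_wick x : `|x |*| x| <= wick g x.
Proof.
rewrite ler_norml bilin_le_wick andbT /wick.
have := mulr_ge0 (sqr_ge0 (g |*| x)) (ltW (gg0)).
have : 0 <= (g |*| x) ^+ 2 / (g |*| g) by rewrite divr_ge0 ?sqr_ge0 ?ltW.
by move=> *; lra.
Qed.

(** The Lorentzian pairing is controlled by the positive norm: reverse Cauchy-Schwarz for
    [t *: x - y] bounds the quadratic in [t] below by [(t (g.x) + g.y)^2 / g.g]. *)
Lemma wick_CS x y : (x |*| y) ^+ 2 <= wick g x * wick g y.
Proof.
apply: discriminant_le => [|t]; first exact: wick_ge0.
have := sqr_bilin_ge (t *: x - y).
rewrite /wick !bE (bilinC symA y x).
have := sqr_ge0 (t * (g |*| x) + g |*| y).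
move: (g |*| g) (g |*| x) (g |*| y) gg0 => p a b p0.
move=> /(@mulr_ge0 _ _ (p^-1)); rewrite invr_ge0 ltW // => /(_ isT) h1 h2.
by lra.
Qed.

Lemma wickD_le x y : wick g (x + y) <= 2 * wick g x + 2 * wick g y.
Proof.
have := wick_ge0 (x - y); rewrite /wick !bE (bilinC symA y x).
by move: (g |*| g) (g |*| x) (g |*| y) gg0 => p a b p0 h; lra.
Qed.

(** * Spread of weighted vectors around their average *)

Section Spread.
Variables (I : finType) (P : pred I) (a : I -> R) (y : I -> 'rV[R]_n).
Hypothesis a0 : forall i, P i -> 0 <= a i.
Let mu := \sum_(i | P i) a i.
Hypothesis mu0 : 0 < mu.
Variable wavg : 'rV[R]_n.
Hypothesis wavgE : mu *: wavg = \sum_(i | P i) a i *: y i.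

Lemma bilin_wavg u : \sum_(i | P i) a i * (u |*| y i) = mu * (u |*| wavg).
Proof. by rewrite -bilin_sumr -wavgE bilinZr. Qed.

(** Convexity: [wick g] lies above its tangent at [wavg], and the weighted sum of the tangent values
    is [mu * wick g wavg]. *)
Lemma wick_wavg_le D : (forall i, P i -> wick g (y i) <= D) -> wick g wavg <= D.
Proof.
move=> yD; rewrite -(ler_pM2l mu0).
pose h i := a i * D - a i * (2 * (2 * (g |*| wavg) / (g |*| g) * (g |*| y i) -
      wavg |*| y i) - wick g wavg).
have : 0 <= \sum_(i | P i) h i.
  apply: sumr_ge0 => i Pi; rewrite /h -mulrBr mulr_ge0 ?a0 //.
  have := wick_ge0 (y i - wavg); have := yD _ Pi.
  rewrite /wick !bE (bilinC symA (y i) wavg).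
  by move: (g |*| g) (g |*| y i) (g |*| wavg) gg0 => p b c p0 h1 h2; lra.
have -> : \sum_(i | P i) h i = mu * D - (2 * (2 * (g |*| wavg) / (g |*| g) *
   (mu * (g |*| wavg)) - mu * (wavg |*| wavg)) - mu * wick g wavg).
  rewrite -!bilin_wavg /mu !mulr_suml !mulr_sumr -!sumrB.
  rewrite mulr_sumr -sumrB -sumrB.
  by apply: eq_bigr => i _; rewrite /h; ring.
rewrite /wick => h1; rewrite -subr_ge0; apply: le_trans h1 _.
rewrite le_eqVlt; apply/predU1P; left; field; by rewrite gt_eqF.
Qed.

(** In the application [c] is [j_0], [X i] is [m_0^2], [bet] is [c_1.c_1 / 12], and [cy] is the
    phase condition with its common constant [kap]. *)
Variables (c kap k D bet : R) (X : I -> R).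
Let q u := (u |*| u) / 4 + bet.
Hypothesis Xk : forall i, P i -> (X i) ^+ 2 <= k ^+ 2.
Hypothesis yD : forall i, P i -> wick g (y i) <= D.
Hypothesis cy : forall i, P i -> c * (g |*| y i) = kap - X i * q (y i).
Hypothesis kD : k ^+ 2 * D <= c ^+ 2 * (g |*| g).

(* The deviation [e] of [y i] from the average satisfies
   [e.e = 2 (g.e)^2 / g.g - wick g e], and the last term absorbs the part of the
   variation of [q] that is linear in [e]. *)
Lemma weighted_spread_le :
  c ^+ 2 * (g |*| g) * (\sum_(i | P i) a i * (y i |*| y i) - mu * (wavg |*| wavg))
    <= 4 * k ^+ 2 * mu * q wavg ^+ 2.
Proof.
have wD := wick_wavg_le yD.
have D0 : 0 <= D by exact: le_trans (wick_ge0 _) wD.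
pose r := c * (g |*| wavg) - kap.
pose G := g |*| g.
(* With [e = y i - wavg], [h i] is [a i] times [4 k^2 q(wavg)^2 - 4 r c (g.e) - c^2 G (e.e)]. The
   middle term sums to zero over [i]; it is inserted to complete the square [(c (g.e) + r)^2], which
   the phase condition bounds. *)
pose h i := a i * (4 * k ^+ 2 * q wavg ^+ 2) -
   4 * r * c * (a i * (g |*| y i)) + 4 * r * c * (g |*| wavg) * a i -
   c ^+ 2 * G * (a i * (y i |*| y i)) + 2 * c ^+ 2 * G * (a i * (wavg |*| y i))
   - c ^+ 2 * G * (wavg |*| wavg) * a i.
have : 0 <= \sum_(i | P i) h i.
  apply: sumr_ge0 => i Pi.
  pose e := y i - wavg.
  have h1 : (c * (g |*| e) + r) ^+ 2 <= k ^+ 2 * q (y i) ^+ 2.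
    have -> : c * (g |*| e) + r = - (X i * q (y i)).
      by rewrite /e /r !bE mulrBr cy //; ring.
    by rewrite sqrrN exprMn ler_wpM2r ?sqr_ge0 ?Xk.
  have h2 : q (y i) = q wavg + (y i + wavg) |*| e / 4.
    by rewrite /q /e !bE (bilinC symA (y i) wavg); field.
  have h3 : q (y i) ^+ 2 <= 2 * q wavg ^+ 2 + D / 2 * wick g e.
    have := wick_CS (y i + wavg) e; have := wickD_le (y i) wavg.
    have := yD Pi; have := wick_ge0 e.
    have := sqr_ge0 (q wavg - (y i + wavg) |*| e / 4).
    rewrite h2.
    move: (_ |*| e) (q wavg) (wick g e) (wick g (y i + wavg)).
    move=> s Q W W' k1 k2 k3 k4 k5.
    have k6 : W' * W <= 4 * D * W by rewrite ler_wpM2r //; lra.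
    by lra.
  have h4 : k ^+ 2 * D * wick g e <= c ^+ 2 * G * wick g e.
    by rewrite ler_wpM2r ?wick_ge0.
  have h5 : k ^+ 2 * q (y i) ^+ 2 <= k ^+ 2 * (2 * q wavg ^+ 2 + D / 2 * wick g e).
    by rewrite ler_wpM2l ?sqr_ge0.
  have h6 : G * (e |*| e) = 2 * (g |*| e) ^+ 2 - G * wick g e.
    by rewrite /wick -/G; field; rewrite gt_eqF.
  have -> : h i = a i * (4 * k ^+ 2 * q wavg ^+ 2 - 4 * r * c * (g |*| e)
      - c ^+ 2 * (G * (e |*| e))).
    by rewrite /h /e !bE (bilinC symA (y i) wavg); ring.
  rewrite mulr_ge0 ?a0 // h6.
  have := sqr_ge0 r.
  move: (g |*| e) (wick g e) (q wavg) (q (y i)) h1 h3 h4 h5.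
  move=> ge W Q Q' h1 h3 h4 h5 h7.
  by lra.
have -> : \sum_(i | P i) h i = 4 * k ^+ 2 * mu * q wavg ^+ 2
   - c ^+ 2 * G * (\sum_(i | P i) a i * (y i |*| y i) - mu * (wavg |*| wavg)).
  rewrite /h !(sumrB, big_split) /= -!mulr_suml -!mulr_sumr !bilin_wavg -/mu.
  by ring.
by rewrite subr_ge0.
Qed.

End Spread.
End Lorentz.

(** * The triple intersection form in terms of the base form *)

Section Threefold.
Variables (R : realType) (p : nat) (G : geometry p).
Hypothesis hG : admissible R G.
Notation C := (Cmat R G).
Notation b := (bvec R G).
Notation "u '|*|' v" := (bilin C u v) (at level 39).

Let symC : C^T = C := adm_sym hG.

Definition tail (u : 'rV[R]_p.+1) : 'rV[R]_p := \row_i u 0 (lift ord0 i).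

Lemma CmatC i j : C i j = C j i.
Proof. by rewrite -{1}symC mxE. Qed.

Lemma delta_coord i j : (delta_mx 0 i : 'rV[R]_p) 0 j = (j == i)%:R.
Proof. by rewrite mxE eqxx. Qed.

Lemma bilin_delta i j : delta_mx 0 i |*| delta_mx 0 j = C i j.
Proof. by rewrite /bilin -rowE trmx_delta -colE mxE [LHS]mxE. Qed.

Lemma K00E i : K00 R G i = delta_mx 0 i |*| b.
Proof.
rewrite bilinE (bigD1 i) //= [X in _ + X]big1 ?addr0; last first.
  move=> k /negbTE ki; rewrite big1 // => j _.
  by rewrite delta_coord ki !mul0r.
by apply: eq_bigr => j _; rewrite delta_coord eqxx mul1r mulrC.
Qed.

Lemma bilin_coord u v : u |*| v = \sum_i u 0 i * (delta_mx 0 i |*| v).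
Proof.
rewrite (bilinC symC) {1}(row_sum_delta u) bilin_sumr.
by apply: eq_bigr => i _; rewrite (bilinC symC).
Qed.

Lemma bilin_b u : u |*| b = \sum_i u 0 i * K00 R G i.
Proof. by rewrite bilin_coord; apply: eq_bigr => i _; rewrite K00E. Qed.

Lemma K000E : K000 R G = b |*| b.
Proof.
rewrite bilinE; apply: eq_bigr => i _; apply: eq_bigr => j _; by rewrite mulrAC.
Qed.

(** On [X] one has [D_0^2 = D_0 c_1], so beyond the first factor [D_0] each further one acts as
    [c_1] on the base. *)
Lemma KformE u v w : Kform G u v w =
  u 0 0 * v 0 0 * w 0 0 * (b |*| b)
  + u 0 0 * v 0 0 * (tail w |*| b) + u 0 0 * w 0 0 * (tail v |*| b)
  + v 0 0 * w 0 0 * (tail u |*| b)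
  + u 0 0 * (tail v |*| tail w) + v 0 0 * (tail u |*| tail w)
  + w 0 0 * (tail u |*| tail v).
Proof.
have S0 (F : 'I_p.+1 -> R) : \sum_I F I = F ord0 + \sum_i F (lift ord0 i).
  by rewrite big_ord_recl.
pose k I J := \sum_L w 0 L * Kcoef R G I J L.
have -> : Kform G u v w = \sum_I u 0 I * \sum_J v 0 J * k I J.
  rewrite /Kform; apply: eq_bigr => I _; rewrite mulr_sumr; apply: eq_bigr => J _.
  by rewrite !mulr_sumr; apply: eq_bigr => L _; rewrite !mulrA.
have tE i (x : 'rV[R]_p.+1) : x 0 (lift ord0 i) = tail x 0 i by rewrite mxE.
have k00 : k ord0 ord0 = w 0 0 * (b |*| b) + tail w |*| b.
  rewrite /k S0 /Kcoef unlift_none K000E; congr (_ + _).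
  by rewrite [tail w |*| b]bilin_b; apply: eq_bigr => i _; rewrite liftK tE.
have kj j : k ord0 (lift ord0 j) = w 0 0 * K00 R G j + delta_mx 0 j |*| tail w.
  rewrite /k S0 /Kcoef unlift_none !liftK; congr (_ + _).
  rewrite (bilinC symC) bilin_coord.
  by apply: eq_bigr => i _; rewrite liftK tE bilin_delta CmatC.
have kj0 j : k (lift ord0 j) ord0 = w 0 0 * K00 R G j + delta_mx 0 j |*| tail w.
  rewrite -kj; apply: eq_bigr => i _; rewrite /Kcoef unlift_none liftK.
  by case: unlift.
have kij i j : k (lift ord0 i) (lift ord0 j) = w 0 0 * C i j.
  rewrite /k S0 /Kcoef unlift_none !liftK big1 ?addr0 // => l _.
  by rewrite liftK mulr0.
have sb (x y : 'rV[R]_p.+1) :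
    \sum_j x 0 (lift ord0 j) * (y 0 0 * K00 R G j + delta_mx 0 j |*| tail w) =
    y 0 0 * (tail x |*| b) + tail x |*| tail w.
  rewrite bilin_b [tail x |*| tail w]bilin_coord mulr_sumr -big_split /=.
  by apply: eq_bigr => i _; rewrite tE; ring.
rewrite S0 !S0 k00; under eq_bigr do rewrite kj.
under [X in _ + X]eq_bigr => i _.
  rewrite S0 kj0; under eq_bigr => j _ do rewrite kij mulrCA tE.
  rewrite -mulr_sumr.
  have -> : \sum_j tail v 0 j * C i j = delta_mx 0 i |*| tail v.
    rewrite (bilinC symC) bilin_coord.
    by apply: eq_bigr => j _; rewrite bilin_delta CmatC.
  rewrite mulrDr (mulrCA (u 0 _)).
  over.
rewrite big_split /= -mulr_sumr !sb.
have -> : \sum_i u 0 (lift ord0 i) * (w 0 0 * (delta_mx 0 i |*| tail v)) =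
    w 0 0 * (tail u |*| tail v).
  rewrite [tail u |*| _]bilin_coord mulr_sumr.
  by apply: eq_bigr => i _; rewrite tE; ring.
by ring.
Qed.
End Threefold.

(** * Positivity on the base and the large radius regime *)

Section BaseGeometry.
Variables (R : realType) (p : nat) (G : geometry p).
Hypothesis hG : admissible R G.
Hypothesis p0 : (0 < p)%N.
Notation C := (Cmat R G).
Notation b := (bvec R G).
Notation "u '|*|' v" := (bilin C u v) (at level 39).
Let symC : C^T = C := adm_sym hG.
Let lorC : reverse_CS C := signature_reverse_CS symC (adm_sign hG) (prednK p0).
Let bE := (bilinDl, bilinDr, bilinNl, bilinNr, bilinZl, bilinZr).

Lemma Kform_D0 u : Kform G u u (Dclass R ord0) =
  u 0 0 ^+ 2 * (b |*| b) + 2 * u 0 0 * (tail u |*| b) + tail u |*| tail u.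
Proof.
rewrite (KformE hG).
have -> : tail (Dclass R (ord0 : 'I_p.+1)) = 0.
  by apply/rowP => i; rewrite /Dclass !mxE eqxx.
have -> : Dclass R (ord0 : 'I_p.+1) 0 0 = 1 :> R by rewrite /Dclass mxE !eqxx.
rewrite bilin0r (bilinC symC 0) bilin0r; ring.
Qed.

Lemma Kform_Dbase u i : Kform G u u (Dclass R (lift ord0 i)) =
  u 0 0 ^+ 2 * K00 R G i + 2 * u 0 0 * (delta_mx 0 i |*| tail u).
Proof.
rewrite (KformE hG) K00E.
have -> : tail (Dclass R (lift ord0 i)) = delta_mx 0 i.
  apply/rowP => j; rewrite /Dclass !mxE eqxx /=.
  by rewrite -(inj_eq val_inj) /= /bump /= !add1n eqSS.
have -> : Dclass R (lift ord0 i) 0 0 = 0 :> R by rewrite /Dclass mxE.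
rewrite (bilinC symC (tail u) (delta_mx 0 i)); ring.
Qed.

Lemma K00_ge1 i : 1 <= K00 R G i.
Proof.
have [/intrP[z ->] z0] := adm_K00 hG i.
by move: z0; rewrite ltr0z ler1z gtz0_ge1.
Qed.

Lemma Cmat_ge0 i j : 0 <= C i j.
Proof.
have [t [t0 cone]] := adm_cone hG.
rewrite -bilin_delta.
exact: (closed_light_cone_bilin_ge0 symC lorC t0 (cone i) (cone j)).
Qed.

(** A zero row sum of nonnegative entries would make [K00] vanish; integrality does the rest. *)
Lemma Cmat_row_sum_ge1 i : 1 <= \sum_k C i k.
Proof.
have C0 : \sum_k C i k != 0.
  apply/eqP => C0; have [_] := adm_K00 hG i; rewrite lt_neqAle => /andP[/eqP[]].
  rewrite /K00 big1 // => j _.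
  move/eqP: C0; rewrite psumr_eq0 => [|k _]; last exact: Cmat_ge0.
  by move/allP => /(_ j (mem_index_enum _)) /eqP ->; rewrite mulr0.
have : 0 <= \sum_k C i k by apply: sumr_ge0 => k _; exact: Cmat_ge0.
move: C0; have -> : \sum_k C i k = (\sum_k geoC G i k)%:~R.
  by rewrite rmorph_sum; apply: eq_bigr => k _; rewrite mxE.
by rewrite intr_eq0 ler0z ler1z; lia.
Qed.

Lemma bb_gt0 : 0 < b |*| b.
Proof.
have [i bi] : exists i, b 0 i != 0.
  apply/existsP; rewrite -negb_forall; apply/negP => /forallP b0.
  have := K00_ge1 (Ordinal p0); rewrite /K00 big1 ?ler10 // => j _.
  by rewrite (eqP (b0 j)) mul0r.
rewrite (bilin_b hG) (bigD1 i) //= ltr_wpDr //.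
  apply: sumr_ge0 => j _; rewrite mulr_ge0 ?(adm_b hG) //.
  exact: le_trans (K00_ge1 j).
rewrite mulr_gt0 ?(lt_le_trans ltr01 (K00_ge1 i)) //.
by rewrite lt_neqAle eq_sym bi (adm_b hG).
Qed.

Lemma bilin_le_xpair i k v : i != k ->
  v |*| v <= 2 * xpair R G i k * (delta_mx 0 i |*| v) * (delta_mx 0 k |*| v).
Proof.
move=> ik; have [_ [_ /(_ v) Mv]] := adm_x hG ik.
rewrite -subr_ge0; suff -> : 2 * xpair R G i k * (delta_mx 0 i |*| v) *
  (delta_mx 0 k |*| v) - v |*| v = bilin (Mmat R G i k) v v by [].
have dE l : delta_mx 0 l |*| v = \sum_j v 0 j * C l j.
  rewrite (bilinC symC) (bilin_coord hG); apply: eq_bigr => j _.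
  by rewrite bilin_delta (CmatC hG).
rewrite !dE [bilin (Mmat _ _ _ _) _ _]bilinE [v |*| v]bilinE.
set x := xpair R G i k.
pose a := \sum_j v 0 j * C i j; pose c := \sum_j v 0 j * C k j.
rewrite -/a -/c.
have -> : 2 * x * a * c = x * (a * c) + x * (c * a) by ring.
rewrite /a /c !mulr_suml !mulr_sumr -big_split -sumrB /=.
apply: eq_bigr => j _; rewrite !mulr_sumr -big_split -sumrB /=.
by apply: eq_bigr => l _; rewrite [Mmat R G i k j l]mxE -/x; ring.
Qed.

(** These are all the size relations needed from [J]. Row sums of [C] at least 1 make [j.j] at least
    [js] times the coordinate sum of [j], whereas [j.c_1] grows only linearly in that sum. *)
Lemma large_radius (s : R) : 0 <= s -> exists js : R, 1 <= js /\
  forall (j0 : R) (j : 'rV[R]_p), js <= j0 -> (forall i, js <= j 0 i) ->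
  let g := j + (j0 / 2) *: b in
  [/\ s * (g |*| b) <= j0 * (g |*| g), s * (g |*| b) ^+ 2 <= (g |*| g) * (j |*| j),
      s * (b |*| b) <= j |*| j, 0 < j |*| j & 0 <= j |*| b].
Proof.
move=> s0; have B0 := bb_gt0.
pose k := \sum_i K00 R G i; pose M := 1 + k ^+ 2 + b |*| b.
have K0 i : 0 <= K00 R G i := le_trans ler01 (K00_ge1 i).
have k0 : 0 <= k by apply: sumr_ge0.
have M0 : 0 <= M by have := sqr_ge0 k; rewrite /M; lra.
(* [M] dominates 1, [k ^+ 2] and [b.b], so [js ^+ 2] exceeds [2 * s] times each of them. *)
exists (1 + 2 * s * M); split; first by rewrite lerDl mulr_ge0 // mulr_ge0.
set js := 1 + _ => j0 j j0js jjs.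
have js1 : 1 <= js by rewrite lerDl mulr_ge0 // mulr_ge0.
have js2 : 2 * s * M <= js ^+ 2.
  have : js * 1 <= js * js by rewrite ler_wpM2l //; lra.
  by rewrite /js; lra.
have j00 i : 0 <= j 0 i by apply: le_trans (jjs i); lra.
pose S := \sum_i j 0 i; pose y := j |*| b.
have y0 : 0 <= y.
  by rewrite /y (bilin_b hG) sumr_ge0 // => i _; rewrite mulr_ge0.
have yS : y <= k * S.
  rewrite /y (bilin_b hG) /S mulr_sumr; apply: ler_sum => i _.
  rewrite mulrC ler_wpM2r // /k (bigD1 i) //= lerDl sumr_ge0 //.
have jS : js <= S.
  rewrite /S (bigD1 (Ordinal p0)) //= (le_trans (jjs (Ordinal p0))) //.
  by rewrite lerDl sumr_ge0.
have jjS : js * S <= j |*| j.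
  rewrite (bilin_coord hG) /S mulr_sumr; apply: ler_sum => i _.
  rewrite mulrC ler_wpM2l // (bilinC symC) (bilin_coord hG).
  apply: (@le_trans _ _ (js * \sum_l C i l)).
    by rewrite ler_peMr ?Cmat_row_sum_ge1 //; lra.
  rewrite mulr_sumr; apply: ler_sum => l _.
  by rewrite bilin_delta (CmatC hG) ler_wpM2r ?Cmat_ge0.
have jj1 : js ^+ 2 <= j |*| j.
  by apply: le_trans jjS; rewrite expr2 ler_wpM2l //; lra.
have kk : 2 * s * k ^+ 2 <= js ^+ 2.
  apply: le_trans js2; rewrite ler_wpM2l ?mulr_ge0 //.
  by rewrite /M; lra.
have sB : 2 * s * (b |*| b) <= j |*| j.
  apply: le_trans jj1; apply: le_trans js2; rewrite ler_wpM2l ?mulr_ge0 //.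
  by rewrite /M; have := sqr_ge0 k; lra.
have sj : 2 * s <= j0 ^+ 2.
  apply: (@le_trans _ _ (js ^+ 2)); last by rewrite lerXn2r ?nnegrE; lra.
  apply: le_trans js2; rewrite ler_peMr ?mulr_ge0 // /M.
  by have := sqr_ge0 k; lra.
have jjy : 2 * s * y ^+ 2 <= (j |*| j) ^+ 2.
  have S0 : 0 <= S by lra.
  have js0 : 0 <= js by lra.
  apply: (@le_trans _ _ ((js * S) ^+ 2)); last first.
    by rewrite lerXn2r ?nnegrE ?(le_trans _ jjS) ?mulr_ge0.
  apply: (@le_trans _ _ (2 * s * (k * S) ^+ 2)).
    by rewrite ler_wpM2l ?mulr_ge0 // lerXn2r ?nnegrE ?mulr_ge0.
  by rewrite !exprMn mulrA ler_wpM2r ?sqr_ge0.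
cbv zeta; rewrite !bE (bilinC symC b j) -/y.
move: (j |*| j) (b |*| b) B0 sB jj1 jjy => q B B0 sB jj1 jjy.
have q0 : 0 < q by apply: lt_le_trans jj1; rewrite exprn_gt0 //; lra.
have j0p : 0 < j0 by lra.
split => //.
- have h1 : y * (2 * s) <= y * j0 ^+ 2 by rewrite ler_wpM2l.
  have h2 : (j0 * B) * (2 * s) <= (j0 * B) * j0 ^+ 2.
    by rewrite ler_wpM2l // mulr_ge0; lra.
  have h3 : 0 < j0 * q by rewrite mulr_gt0.
  have h4 : 0 <= s * y by rewrite mulr_ge0.
  by lra.
- have h2 : (j0 ^+ 2 * B) * (2 * s * B) <= (j0 ^+ 2 * B) * q.
    by rewrite ler_wpM2l // mulr_ge0 ?sqr_ge0 //; lra.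
  have h3 : 0 <= j0 * y * q by rewrite !mulr_ge0 //; lra.
  have h4 : 0 <= s * (y - j0 * B / 2) ^+ 2 by rewrite mulr_ge0 ?sqr_ge0.
  by lra.
- by have := mulr_ge0 s0 (ltW B0); lra.
Qed.

End BaseGeometry.

(** * Supersymmetry conditions for a single flux *)

Section Stack.
Variables (R : realType) (p : nat) (G : geometry p).
Hypothesis hG : admissible R G.
Hypothesis p0 : (0 < p)%N.
Notation C := (Cmat R G).
Notation b := (bvec R G).
Notation "u '|*|' v" := (bilin C u v) (at level 39).
Let symC : C^T = C := adm_sym hG.
Let lorC : reverse_CS C := signature_reverse_CS symC (adm_sign hG) (prednK p0).
Let bE := (bilinDl, bilinDr, bilinNl, bilinNr, bilinZl, bilinZr).
Implicit Types J u : 'rV[R]_p.+1.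

(* The [U] in [u = u_0 (sigma + c_1 / 2) + U]; in terms of it the cubic form is
   [3 u_0 U.U + u_0^3 c_1.c_1 / 4]. *)
Definition centre (u : 'rV[R]_p.+1) : 'rV[R]_p := tail u + (u 0 0 / 2) *: b.

(** The normalisation turns the tadpole of [D_i] into [- m_0^2 (y.D_i)] and that of [D_0] into
    [m_0^2 (y - c_1)^2 / 4]. *)
Definition slope (u : 'rV[R]_p.+1) : 'rV[R]_p := - (2 / u 0 0) *: centre u.

Lemma tail_slope u : u 0 0 != 0 -> tail u = - (u 0 0 / 2) *: (slope u + b).
Proof.
move=> u0; rewrite /slope /centre; apply/rowP => i; rewrite !mxE.
by field.
Qed.

Lemma Kform_D0_slope u : u 0 0 != 0 ->
  Kform G u u (Dclass R ord0) = u 0 0 ^+ 2 * ((slope u - b) |*| (slope u - b)) / 4.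
Proof.
move=> u0; rewrite (Kform_D0 hG) (tail_slope u0); move: (slope u) => y.
by rewrite !bE (bilinC symC y b); field.
Qed.

Lemma Kform_Dbase_slope u i : u 0 0 != 0 ->
  Kform G u u (Dclass R (lift ord0 i)) = - (u 0 0 ^+ 2 * (delta_mx 0 i |*| slope u)).
Proof.
move=> u0; rewrite (Kform_Dbase hG) (tail_slope u0); move: (slope u) => y.
by rewrite !bE -K00E; field.
Qed.

Lemma phase_slope J u : u 0 0 != 0 ->
  3 * Kform G J J u = Kform G u u u ->
  J 0 0 * (centre J |*| slope u) = J 0 0 * (centre J |*| b) + tail J |*| tail J
    - u 0 0 ^+ 2 * ((slope u |*| slope u) / 4 + (b |*| b) / 12).
Proof.
move=> u0; rewrite !(KformE hG) (tail_slope u0) /centre.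
move: (slope u) (tail J) (J 0 0) => y j j0.
rewrite !bE (bilinC symC y b) (bilinC symC j b) ?(bilinC symC y j).
move=> h; apply: (mulfI u0); move: h.
move: (u 0 0) (b |*| b) (b |*| y) (y |*| y) (b |*| j) (j |*| y) (j |*| j).
by move=> m B by' yy bj jy jj h; lra.
Qed.

(** Eliminating [g.y] between the phase and positivity conditions gives the claim multiplied by
    [m_0^2 + j_0^2]. *)
Lemma positive_slope J u : 0 < J 0 0 -> u 0 0 != 0 ->
  3 * Kform G J J u = Kform G u u u ->
  3 * Kform G J u u < Kform G J J J ->
  u 0 0 ^+ 2 * ((slope u |*| slope u) / 4 + (b |*| b) / 12) <
    centre J |*| centre J + J 0 0 ^+ 2 * (b |*| b) / 12.
Proof.
move=> J0 u0 /(phase_slope u0); rewrite !(KformE hG) (tail_slope u0) /centre.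
move: (slope u) (tail J) (J 0 0) J0 => y j j0 J0.
rewrite !bE (bilinC symC y b) (bilinC symC j b) ?(bilinC symC y j).
move: (u 0 0) (b |*| b) (b |*| y) (y |*| y) (b |*| j) (j |*| y) (j |*| j).
move=> m B by' yy bj jy jj h1 h2.
have d0 : 0 < m ^+ 2 + j0 ^+ 2 by rewrite ltr_wpDl ?sqr_ge0 // exprn_gt0.
rewrite -(ltr_pM2l d0).
have := congr1 (fun t => m ^+ 2 * t) h1 => /= h3.
rewrite -(ltr_pM2l J0) in h2.
by lra.
Qed.

(** Without a [D_0] component the phase condition says that the flux is orthogonal to the time-like
    [g]. *)
Lemma Kform_D0_le0 J u : 0 < J 0 0 -> u 0 0 = 0 -> 0 < centre J |*| centre J ->
  3 * Kform G J J u = Kform G u u u -> Kform G u u (Dclass R ord0) <= 0.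
Proof.
move=> J0 u0 gg; rewrite (Kform_D0 hG) !(KformE hG) u0 => h.
have gu : centre J |*| tail u = 0.
  apply: (mulfI (lt0r_neq0 J0)); rewrite /centre !bE (bilinC symC b).
  by move: h; rewrite !(mul0r, mulr0) => h; lra.
rewrite expr0n !(mul0r, mulr0) !add0r -(pmulr_rle0 _ gg).
by have := lorC (tail u) gg; rewrite gu expr0n.
Qed.

End Stack.

(** * Scalar estimates for one stack with nonzero [m_0] *)

(* In terms of one flux, [X = m_0^2], [h = g.y], [yy = y.y], [gg = g.g],
   [ga = g.c_1], [jj = j.j] and [B = c_1.c_1], with [j] the base part of [J]. *)
Section StackBounds.
Variables (R : realFieldType) (X j0 h yy gg ga jj B : R).
Hypotheses (X1 : 1 <= X) (j1 : 1 <= j0) (B0 : 0 < B) (jj0 : 0 < jj) (gg0 : 0 < gg).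
Hypothesis gE : gg + j0 ^+ 2 * B / 4 = j0 * ga + jj.
Hypothesis gaB : j0 * B / 2 <= ga.
Hypothesis ga1 : 1000 * ga <= j0 * gg.
Hypothesis ga2 : 1000 * ga ^+ 2 <= gg * jj.
Hypothesis jjB : 1000 * B <= jj.
Let q := yy / 4 + B / 12.
Hypothesis phase : j0 * h = j0 * ga + jj - X * q.
Hypothesis pos : X * q < gg + j0 ^+ 2 * B / 12.
Hypothesis RCS : gg * yy <= h ^+ 2.

Lemma slope_bound_lower : j0 * B / 6 < h.
Proof.
rewrite -(ltr_pM2l (lt_le_trans ltr01 j1)) phase.
by move: gE pos; lra.
Qed.

Hypothesis Xh : X * h <= 12 * ga.

Let X0 : 0 < X := lt_le_trans ltr01 X1.
Let j00 : 0 < j0 := lt_le_trans ltr01 j1.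
Let h0 : 0 < h.
Proof.
by apply: le_lt_trans slope_bound_lower; rewrite divr_ge0 // mulr_ge0 // ltW.
Qed.
Let ga0 : 0 < ga.
Proof. apply: lt_le_trans gaB; rewrite divr_gt0 // mulr_gt0 //. Qed.

Let X2yy : 1000 * (X ^+ 2 * yy) <= 144 * jj.
Proof.
rewrite -(ler_pM2l gg0).
have : (X * h) ^+ 2 <= (12 * ga) ^+ 2.
  by rewrite lerXn2r // nnegrE mulr_ge0 // ltW.
have : X ^+ 2 * (gg * yy) <= X ^+ 2 * h ^+ 2 by rewrite ler_wpM2l ?sqr_ge0.
by move: ga2; lra.
Qed.

(** The phase condition times [X] writes [X (j0 ga + jj)] as [j0 X h], at most [12 j0 ga], plus
    terms small against [jj] and [X gg]. The value 13 is 12 with room for these. *)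
Lemma flux_bound : X <= 13.
Proof.
have h1 : X * (j0 * B) <= 72 * ga.
  have : X * (j0 * B / 6) <= X * h by rewrite ler_wpM2l // ltW // slope_bound_lower.
  by move: Xh; lra.
have h2 : 1000 * (X * B) <= 72 * gg.
  rewrite -(ler_pM2l j00); move: h1 ga1; lra.
have h3 : X * (1000 * (X * B)) <= X * (72 * gg) by rewrite ler_wpM2l // ltW.
have h4 : X * (j0 * h) = X * (j0 * ga + jj) - X * (X * q) by rewrite phase; ring.
have h5 : j0 * (X * h) <= j0 * (12 * ga) by rewrite ler_wpM2l // ltW.
have Gg : X * gg <= X * (j0 * ga + jj).
  rewrite ler_wpM2l ?(ltW X0) // -gE lerDl divr_ge0 // mulr_ge0 ?sqr_ge0 //.
  exact: ltW.
have G0 : 0 < j0 * ga + jj by rewrite addr_gt0 // mulr_gt0.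
have Gj : 0 < j0 * ga by rewrite mulr_gt0.
have h6 : X * (j0 * ga + jj) =
    j0 * (X * h) + X ^+ 2 * yy / 4 + X * (X * B) / 12.
  by move: h4; rewrite /q; lra.
rewrite -(ler_pM2r G0); move: jj0 X2yy h3 h5 h6 Gg Gj; lra.
Qed.

(** By the phase condition [j0 (h - ga) = jj - X q], and [X q] is small against [jj]. *)
Lemma slope_bound_gt : ga < h.
Proof.
have h1 : 1000 * (X * yy) <= 144 * jj.
  have [y0|y0] := leP yy 0.
    have := mulr_ge0_le0 (ltW X0) y0; move: jj0; lra.
  apply: le_trans X2yy; rewrite ler_wpM2l // expr2 -mulrA ler_peMl //.
  by rewrite mulr_ge0 // ltW.
have h2 : X * B <= 13 * B by rewrite ler_wpM2r ?flux_bound // ltW.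
rewrite -(ltr_pM2l j00) phase /q; move: h1 h2 jjB jj0; lra.
Qed.

(** The left side is [wick g y]. A very negative [yy] would make [q] negative; then [- q <= - X q],
    which the phase condition bounds through [h]. *)
Lemma slope_bound_wick : 2 * h ^+ 2 / gg - yy <= 50 * (j0 * ga).
Proof.
have hX : h <= 12 * ga by apply: le_trans Xh; rewrite ler_peMl // ltW.
have h1 : h ^+ 2 / gg <= j0 * ga / 5.
  rewrite ler_pdivrMr //.
  have : h ^+ 2 <= (12 * ga) ^+ 2 by rewrite lerXn2r // nnegrE ?mulr_ge0 // ltW.
  have : ga * (1000 * ga) <= ga * (j0 * gg) by rewrite ler_wpM2l // ltW.
  have : 0 <= ga * (j0 * gg) by rewrite !mulr_ge0 // ltW.
  by lra.
have g1 : 0 <= j0 * ga by rewrite mulr_ge0 // ltW.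
have h2 : - q <= 12 * (j0 * ga).
  have [q0|q0] := leP 0 q; first by lra.
  have : X * q <= 1 * q by rewrite ler_wnM2r // ltW.
  have : j0 * h <= j0 * (12 * ga) by rewrite ler_wpM2l // ltW.
  by move: phase jj0; lra.
have h3 : B <= 2 * (j0 * ga).
  have : ga * 1 <= ga * j0 by rewrite ler_wpM2l // ltW.
  have : B * 1 <= B * j0 by rewrite ler_wpM2l // ltW.
  by move: gaB; lra.
have -> : 2 * h ^+ 2 / gg = 2 * (h ^+ 2 / gg) by rewrite mulrA.
by move: h1 h2 h3 g1; rewrite /q; lra.
Qed.

End StackBounds.

(** * Tadpole sums over all stacks of a configuration *)

Section Assembly.
Variables (R : realType) (p : nat) (G : geometry p).
Hypothesis hG : admissible R G.
Hypothesis p0 : (0 < p)%N.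
Notation C := (Cmat R G).
Notation b := (bvec R G).
Notation K := (K00 R G).
Notation "u '|*|' v" := (bilin C u v) (at level 39).
Let symC : C^T = C := adm_sym hG.
Let lorC : reverse_CS C := signature_reverse_CS symC (adm_sign hG) (prednK p0).
Let bE := (bilinDl, bilinDr, bilinNl, bilinNr, bilinZl, bilinZr).

Section Config.
Variable cfg : configuration R p.
Hypothesis hS : supersymmetric G cfg.
Let J := kahler cfg.
Let j0 := J 0 0.
Let j := tail J.
Let g := centre G J.
Variable s : R.
Hypothesis s1 : 10 ^+ 6 <= s.
Hypothesis j01 : 1 <= j0.
Hypothesis sga : s * (g |*| b) <= j0 * (g |*| g).
Hypothesis sga2 : s * (g |*| b) ^+ 2 <= (g |*| g) * (j |*| j).
Hypothesis sB : s * (b |*| b) <= j |*| j.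
Hypothesis jj0 : 0 < j |*| j.
Hypothesis jb0 : 0 <= j |*| b.

Let u (al : 'I_(nstacks cfg)) : 'rV[R]_p.+1 := flux al.
Let N (al : 'I_(nstacks cfg)) : R := (mult al)%:R.
Let X al := u al 0 0 ^+ 2.
Let y al := slope G (u al).
Let a al := N al * X al.
Let charged al := u al 0 0 != 0.
Let mu := \sum_(al | charged al) a al.
Let S := \sum_(al | charged al) a al *: y al.

Lemma centre_gt0 i : 0 < g 0 i.
Proof.
rewrite /g /centre /tail !mxE ltr_wpDr //.
  rewrite mulr_ge0 //; first by rewrite divr_ge0 //; apply: le_trans j01.
  by have := adm_b hG i; rewrite mxE.
exact: susy_J hS _.
Qed.

Lemma centre_sqrE : g |*| g + j0 ^+ 2 * (b |*| b) / 4 = j0 * (g |*| b) + j |*| j.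
Proof. by rewrite /g /centre -/j0 -/j !bE (bilinC symC b j); field. Qed.

Lemma centre_bE : g |*| b = j |*| b + j0 * (b |*| b) / 2.
Proof. by rewrite /g /centre -/j0 -/j !bE; ring. Qed.

Let j0_gt0 : 0 < j0 := lt_le_trans ltr01 j01.
Let B0 : 0 < b |*| b := bb_gt0 hG p0.

Let gaB : j0 * (b |*| b) / 2 <= g |*| b.
Proof. by rewrite centre_bE lerDr. Qed.

Let ga0 : 0 < g |*| b.
Proof. by apply: lt_le_trans gaB; rewrite divr_gt0 // mulr_gt0. Qed.

Let s0 : 0 < s.
Proof. by apply: lt_le_trans s1; rewrite exprn_gt0. Qed.

Let gg0 : 0 < g |*| g.
Proof. by rewrite -(pmulr_rgt0 _ j0_gt0) (lt_le_trans _ sga) // mulr_gt0. Qed.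

Let weaken (r t : R) (c : R) : c <= 10 ^+ 6 -> 0 <= r -> s * r <= t -> c * r <= t.
Proof. by move=> c6 r0; apply: le_trans; rewrite ler_wpM2r // (le_trans c6). Qed.

Lemma flux0_int al : u al 0 0 \is a Num.int.
Proof.
by rewrite /u /flux mxE; have /intrP[z ->] := susy_int0 hS al; rewrite ratr_int.
Qed.

Lemma mult_ge1 al : 1 <= N al.
Proof. by rewrite /N ler1n (susy_mult hS). Qed.

Lemma charge_sqr_ge1 al : charged al -> 1 <= X al.
Proof.
rewrite /charged /X; have /intrP[z ->] := flux0_int al.
rewrite intr_eq0 -rmorphXn /= ler1z => z0.
by rewrite -gtz0_ge1 exprn_even_gt0.
Qed.

Lemma a_ge0 al : 0 <= a al.
Proof. by rewrite /a mulr_ge0 ?sqr_ge0 // (le_trans ler01 (mult_ge1 al)). Qed.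

Lemma tadpole_base i : delta_mx 0 i |*| S = 12 * K i - (nD5 cfg (lift ord0 i))%:R.
Proof.
have := susy_tadpole hS (lift ord0 i).
rewrite /Ttad liftK /Tbase (bigID charged) /=.
rewrite [X in _ = _ + X]big1 ?addr0; last first.
  move=> al; rewrite negbK => /eqP u0.
  by rewrite (Kform_Dbase hG) -/(u al) u0 expr0n !(mul0r, mulr0, addr0).
move=> h; rewrite -opprB h bilin_sumr -sumrN; apply: eq_bigr => al al0.
by rewrite (Kform_Dbase_slope hG) // /a mulrN opprK -mulrA.
Qed.

(** The coordinates of [g] are positive, so the tadpoles of the [D_i] can be added with these
    weights and the D5-brane numbers dropped. *)
Lemma sum_slope_le : g |*| S <= 12 * (g |*| b).
Proof.
rewrite (bilin_coord hG) (bilin_b hG) mulr_sumr; apply: ler_sum => i _.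
rewrite tadpole_base mulrBr mulrCA lerBlDr lerDl mulr_ge0 //.
exact: ltW (centre_gt0 i).
Qed.

Let h al := g |*| y al.
Let q al := (y al |*| y al) / 4 + (b |*| b) / 12.

Let phase al : charged al -> j0 * h al = j0 * (g |*| b) + j |*| j - X al * q al.
Proof. by move=> c;  have := phase_slope hG c (susy_phase hS al); apply. Qed.

Let pos al : charged al -> X al * q al < g |*| g + j0 ^+ 2 * (b |*| b) / 12.
Proof.
move=> c; have := positive_slope hG j0_gt0 c (susy_phase hS al) (susy_pos hS al); exact.
Qed.

Let rcs al : g |*| g * (y al |*| y al) <= h al ^+ 2.
Proof. exact: lorC. Qed.

Let h_gt0 al : charged al -> 0 < h al.
Proof.
move=> c; apply: le_lt_trans (slope_bound_lower j01 centre_sqrE (phase c) (pos c)).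
by rewrite divr_ge0 // mulr_ge0 // ltW.
Qed.

Let Xh al : charged al -> X al * h al <= 12 * (g |*| b).
Proof.
(* All terms of [g.S] are positive, so each one is bounded by the sum. *)
move=> c; apply: le_trans sum_slope_le; rewrite bilin_sumr (bigD1 al) //=.
have X0 : 0 <= X al * h al by rewrite mulr_ge0 ?sqr_ge0 // ltW ?h_gt0.
apply: (@le_trans _ _ (a al * h al)).
  by rewrite /a -mulrA ler_peMl // mult_ge1.
rewrite lerDl sumr_ge0 // => be /andP[cb _].
by rewrite mulr_ge0 ?a_ge0 // ltW ?h_gt0.
Qed.

Let ga1 : 1000 * (g |*| b) <= j0 * (g |*| g).
Proof. by apply: weaken sga; [lra | exact: ltW]. Qed.

Let ga2 : 1000 * (g |*| b) ^+ 2 <= g |*| g * (j |*| j).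
Proof. by apply: weaken sga2; [lra | exact: sqr_ge0]. Qed.

Let jjB : 1000 * (b |*| b) <= j |*| j.
Proof. by apply: weaken sB; [lra | exact: ltW]. Qed.

Lemma charge_sqr_le13 al : charged al -> X al <= 13.
Proof.
move=> c; exact: (flux_bound (charge_sqr_ge1 c) j01 B0 jj0 gg0 centre_sqrE gaB
  ga1 ga2 (phase c) (pos c) (rcs al) (Xh c)).
Qed.

Lemma slope_gt al : charged al -> g |*| b < h al.
Proof.
move=> c; exact: (slope_bound_gt (charge_sqr_ge1 c) j01 B0 jj0 gg0 centre_sqrE gaB
  ga1 ga2 jjB (phase c) (pos c) (rcs al) (Xh c)).
Qed.

Lemma slope_wick_le al : charged al -> wick C g (y al) <= 50 * (j0 * (g |*| b)).
Proof.
move=> c; exact: (slope_bound_wick (charge_sqr_ge1 c) j01 B0 jj0 gg0 centre_sqrE gaB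
  ga1 (phase c) (pos c) (Xh c)).
Qed.

Lemma mu_le208 : mu <= 208.
Proof.
(* Sixteen D9-branes, each with squared charge at most 13. *)
have -> : 208 = 13 * (\sum_(al < nstacks cfg) mult al)%N%:R :> R.
  by rewrite (susy_D9 hS) -natrM.
rewrite natr_sum mulr_sumr [leRHS](bigID charged) /=.
rewrite -[mu]addr0 lerD ?sumr_ge0 // => [|al _]; last by rewrite mulr_ge0.
by apply: ler_sum => al c; rewrite /a mulrC ler_wpM2r // charge_sqr_le13.
Qed.

Lemma mu_int : mu \is a Num.int.
Proof.
by apply: rpred_sum => al _; rewrite rpredM ?rpredX ?flux0_int // natr_int.
Qed.

Lemma tadpole0_neutral : (forall al, ~~ charged al) ->
  (nD5 cfg ord0)%:R - T0 R G <= 0.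
Proof.
move=> nc; have := susy_tadpole hS ord0; rewrite /Ttad unlift_none => ->.
apply: sumr_le0 => al _; rewrite mulr_ge0_le0 //.
have /eqP u0 := negbNE (nc al).
exact: (Kform_D0_le0 hG p0 j0_gt0 u0 gg0 (susy_phase hS al)).
Qed.

Section Charged.
Variable al0 : 'I_(nstacks cfg).
Hypothesis c0 : charged al0.

Lemma mu_ge1 : 1 <= mu.
Proof.
rewrite /mu (bigD1 al0) //= -[1]addr0.
rewrite lerD ?sumr_ge0 // => [|al _]; last exact: a_ge0.
by rewrite -[1]mul1r ler_pM ?mult_ge1 ?charge_sqr_ge1.
Qed.

Let mu0 : 0 < mu := lt_le_trans ltr01 mu_ge1.
Let ybar := mu^-1 *: S.
Let Delta := \sum_(al | charged al) a al * (y al |*| y al) - mu * (ybar |*| ybar).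
Let V := S - mu *: b.

Let mu_ybar : mu *: ybar = S.
Proof. by rewrite /ybar scalerA divff ?scale1r // gt_eqF. Qed.

Lemma V_coord i :
  delta_mx 0 i |*| V = (12 - mu) * K i - (nD5 cfg (lift ord0 i))%:R.
Proof. by rewrite /V !bE tadpole_base -K00E; ring. Qed.

Lemma V_coord_int i : delta_mx 0 i |*| V \is a Num.int.
Proof.
have [Ki _] := adm_K00 hG i.
by rewrite V_coord rpredB ?rpredM ?rpredB ?mu_int ?natr_int.
Qed.

(** [g.V] is the weighted sum of the positive numbers [g.y - g.c_1], and [g] has positive
    coordinates. *)
Lemma V_coord_gt0 : exists k, 0 < delta_mx 0 k |*| V.
Proof.
apply/existsP; apply: contraT; rewrite negb_exists => /forallP V0.
have gV : g |*| V <= 0.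
  rewrite (bilin_coord hG) sumr_le0 // => i _.
  by rewrite mulr_ge0_le0 ?(ltW (centre_gt0 i)) // leNgt.
suff : 0 < g |*| V by rewrite ltNge gV.
rewrite /V bilinDr bilinNr bilinZr bilin_sumr /mu mulr_suml -sumrB.
rewrite (bigD1 al0) //= ltr_wpDr //.
  apply: sumr_ge0 => al /andP[c _].
  by rewrite -mulrBr mulr_ge0 ?a_ge0 // subr_ge0 ltW // slope_gt.
rewrite -mulrBr mulr_gt0 ?subr_gt0 ?slope_gt //.
by rewrite mulr_gt0 ?(lt_le_trans ltr01) ?mult_ge1 ?charge_sqr_ge1.
Qed.

Lemma V_sqr_div_muE :
  V |*| V / mu = mu * (ybar |*| ybar) - 2 * (S |*| b) + mu * (b |*| b).
Proof.
rewrite /V -mu_ybar; generalize ybar => z.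
by rewrite !bE (bilinC symC b z); field; exact: lt0r_neq0.
Qed.

(** Over the charged stacks this is the parallel axis identity: the weighted squares of [y - c_1]
    split into [V.V / mu] and the spread [Delta] around [ybar]. *)
Lemma tadpole0_le : 4 * ((nD5 cfg ord0)%:R - T0 R G) <= V |*| V / mu + Delta.
Proof.
have := susy_tadpole hS ord0; rewrite /Ttad unlift_none => ->.
rewrite (bigID charged) /= mulrDr -[leRHS]addr0 lerD //; last first.
  rewrite pmulr_rle0 // sumr_le0 // => al; rewrite negbK => /eqP u0.
  rewrite mulr_ge0_le0 //.
  exact: (Kform_D0_le0 hG p0 j0_gt0 u0 gg0 (susy_phase hS al)).
rewrite V_sqr_div_muE le_eqVlt; apply/orP; left; apply/eqP.
have -> : S |*| b = \sum_(al | charged al) a al * (y al |*| b).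
  rewrite (bilinC symC) bilin_sumr; apply: eq_bigr => al _.
  by rewrite (bilinC symC).
transitivity (\sum_(al | charged al) (a al * (y al |*| y al)
   - 2 * (a al * (y al |*| b)) + a al * (b |*| b))); last first.
  by rewrite big_split sumrB /= -mulr_sumr -mulr_suml -/mu /Delta; ring.
rewrite mulr_sumr; apply: eq_bigr => al c.
rewrite (Kform_D0_slope hG) // -/(u al) -/(y al) /a /X -/(N al).
by move: (y al) => z; rewrite !bE (bilinC symC b z); field.
Qed.

Lemma Delta_le : s * Delta <=
  8788 * (`|V |*| V| / (4 * mu) + `|V |*| b| / 2 + mu * (b |*| b) / 3).
Proof.
pose bet := (b |*| b) / 12; pose D := 50 * (j0 * (g |*| b)).
pose qb := (ybar |*| ybar) / 4 + bet.
have jg : 0 < j0 * (g |*| b) by rewrite mulr_gt0.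
have j1g : 0 < j0 * (g |*| g) by rewrite mulr_gt0.
have X13 al : charged al -> X al ^+ 2 <= 13 ^+ 2.
  by move=> c; rewrite lerXn2r ?nnegrE ?sqr_ge0 // charge_sqr_le13.
have kD : 13 ^+ 2 * D <= j0 ^+ 2 * (g |*| g).
  have : 8450 * (g |*| b) <= j0 * (g |*| g).
    by apply: weaken sga; [lra | exact: ltW].
  by rewrite -(ler_pM2l j0_gt0) /D; lra.
have := weighted_spread_le symC lorC gg0 (fun al _ => a_ge0 al) mu0 mu_ybar X13
  slope_wick_le phase kD.
rewrite -/mu -/Delta -/bet -/qb => spread.
have wy : wick C g ybar <= D.
  exact: (wick_wavg_le symC lorC gg0 (fun al _ => a_ge0 al) mu0 mu_ybar
    slope_wick_le).
have qD : `|qb| <= 13 * (j0 * (g |*| b)).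
  have n1 := le_trans (norm_bilin_le_wick lorC gg0 ybar) wy.
  have n2 : b |*| b <= 2 * (j0 * (g |*| b)).
    have : (g |*| b) * 1 <= (g |*| b) * j0 by rewrite ler_wpM2l // ltW.
    have : (b |*| b) * 1 <= (b |*| b) * j0 by rewrite ler_wpM2l // ltW.
    by move: gaB; lra.
  move: n1; rewrite !ler_norml /D /qb /bet => /andP[n3 n4].
  by apply/andP; split; move: B0; lra.
(* [8788 = 4 * 13 ^ 3]: two factors 13 bound [X], the third comes from replacing one factor [qb] by
   its bound. The ratio [s] of [j0 (g.g)] to [g.c_1] then moves to the left. *)
have s1' : s * Delta <= 8788 * (mu * `|qb|).
  have e1 : qb ^+ 2 <= 13 * (j0 * (g |*| b)) * `|qb|.
    by rewrite -real_normK ?num_real // expr2 ler_wpM2r.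
  have e2 : (j0 * (g |*| g)) * (j0 * Delta) <=
      8788 * (j0 * (g |*| b)) * (mu * `|qb|).
    apply: (@le_trans _ _ (4 * 13 ^+ 2 * mu * qb ^+ 2)).
      by apply: le_trans spread; rewrite le_eqVlt; apply/orP; left; apply/eqP; ring.
    have : mu * qb ^+ 2 <= mu * (13 * (j0 * (g |*| b)) * `|qb|).
      by rewrite ler_wpM2l // ltW.
    by lra.
  have mq : 0 <= mu * `|qb| by rewrite mulr_ge0 // ltW.
  have e3 : s * (g |*| b) * (mu * `|qb|) <= j0 * (g |*| g) * (mu * `|qb|).
    by rewrite ler_wpM2r.
  rewrite -(ler_pM2l (mulr_gt0 j0_gt0 j1g)).
  have : s * ((j0 * (g |*| g)) * (j0 * Delta)) <=
      s * (8788 * (j0 * (g |*| b)) * (mu * `|qb|)) by rewrite ler_wpM2l // ltW.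
  have : j0 * (s * (g |*| b) * (mu * `|qb|)) <= j0 * (j0 * (g |*| g) * (mu * `|qb|)).
    by rewrite ler_wpM2l // ltW.
  by lra.
apply: le_trans s1' _; rewrite ler_wpM2l //.
(* Substituting [ybar = V / mu + c_1] makes [qb] a function of [V] alone. *)
have -> : mu * `|qb| = `|V |*| V / (4 * mu) + V |*| b / 2 + mu * (b |*| b) / 3|.
  rewrite -[X in X * _](gtr0_norm mu0) -normrM; congr `|_|.
  rewrite /qb /bet /V -mu_ybar; generalize ybar => z.
  by rewrite !bE (bilinC symC b z); field; exact: lt0r_neq0.
have m4 : 0 <= 4 * mu by rewrite mulr_ge0 // ltW.
apply: le_trans (ler_normD _ _) _; apply: lerD; last first.
  by rewrite ger0_norm // divr_ge0 // mulr_ge0 // ltW.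
apply: le_trans (ler_normD _ _) _.
by rewrite !normrM !normfV (ger0_norm m4) (ger0_norm (ler0n _ 2)).
Qed.

Lemma charged_summary : exists (m D : R) (v : 'rV[R]_p),
  [/\ 1 <= m <= 208,
      forall i, delta_mx 0 i |*| v \is a Num.int
        /\ delta_mx 0 i |*| v <= (12 - m) * K i,
      exists k, 0 < delta_mx 0 k |*| v,
      4 * ((nD5 cfg ord0)%:R - T0 R G) <= v |*| v / m + D &
      s * D <= 8788 * (`|v |*| v| / (4 * m) + `|v |*| b| / 2 + m * (b |*| b) / 3)].
Proof.
exists mu, Delta, V; split.
- by rewrite mu_ge1 mu_le208.
- by move=> i; split; [exact: V_coord_int | rewrite V_coord lerBlDr lerDl].
- exact: V_coord_gt0.
- exact: tadpole0_le.
- exact: Delta_le.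
Qed.

End Charged.
End Config.

(** * Absorbing the error term [Delta] *)

Definition inv_x_sum :=
  \sum_(ik : 'I_p * 'I_p | ik.1 != ik.2) (xpair R G ik.1 ik.2)^-1.

(** The coefficient of [- V.V] in the bound on the absolute value of [V.c_1] when [V] is
    space-like. *)
Definition error_slope := (\sum_i b 0 i) * inv_x_sum / 2.

Lemma inv_x_sum_ge i k : i != k -> (xpair R G i k)^-1 <= inv_x_sum.
Proof.
move=> ik; rewrite /inv_x_sum (bigD1 (i, k)) //= lerDl.
rewrite sumr_ge0 // => -[m n] /andP[mn _].
by rewrite invr_ge0 ltW //; have [] := adm_x hG mn.
Qed.

Lemma inv_x_sum_ge0 : 0 <= inv_x_sum.
Proof.
by apply: sumr_ge0 => -[m n] mn; rewrite invr_ge0 ltW //; have [] := adm_x hG mn.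
Qed.

Lemma error_slope_ge0 : 0 <= error_slope.
Proof.
rewrite /error_slope divr_ge0 // mulr_ge0 ?inv_x_sum_ge0 // sumr_ge0 // => i _.
exact: adm_b hG i.
Qed.

Section Absorb.
Variables (s mu Delta : R) (V : 'rV[R]_p).
(** The summands of [s] serve different errors: 1 those proportional to [V.V] or [P], [error_slope]
    those from [V.c_1], and the last those proportional to [b.b], since [inv_x_sum * P >= 1]. *)
Hypothesis sE : s = 10 ^+ 6 * (1 + error_slope + (b |*| b) * inv_x_sum).
Hypothesis mu1 : 1 <= mu.
Hypothesis mu208 : mu <= 208.
Hypothesis Vle : forall i, delta_mx 0 i |*| V <= (12 - mu) * K i.
Hypothesis DeltaP : s * Delta <=
  8788 * (`|V |*| V| / (4 * mu) + `|V |*| b| / 2 + mu * (b |*| b) / 3).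

Let K1 i : 1 <= K i := K00_ge1 hG i.
Let b0 i : 0 <= b 0 i := adm_b hG i.
Let B0 : 0 < b |*| b := bb_gt0 hG p0.
Let mu0 : 0 < mu := lt_le_trans ltr01 mu1.
Let s_ge : 10 ^+ 6 * (1 + error_slope) <= s.
Proof.
rewrite sE ler_wpM2l ?exprn_ge0 // lerDl mulr_ge0 ?inv_x_sum_ge0 //.
exact: ltW.
Qed.
Let s_gt0 : 0 < s.
Proof.
by apply: lt_le_trans s_ge; rewrite mulr_gt0 ?exprn_gt0 // ltr_wpDr ?error_slope_ge0.
Qed.

Let norm_div : `|V |*| V| / (4 * mu) = `|V |*| V| / mu / 4.
Proof. by field; exact: lt0r_neq0. Qed.

Section Pair.
Variables (i k : 'I_p).
Hypothesis ik : i != k.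
Let P := xpair R G i k * K i * K k.

Let x0 : 0 < xpair R G i k.
Proof. by have [] := adm_x hG ik. Qed.

Let P0 : 0 < P.
Proof.
have Kp l := lt_le_trans ltr01 (K1 l).
exact: (mulr_gt0 (mulr_gt0 x0 (Kp i)) (Kp k)).
Qed.

Let sP : 10 ^+ 6 * (b |*| b) <= s * P.
Proof.
have xP : xpair R G i k <= P.
  by rewrite /P -mulrA ler_peMr ?(ltW x0) // -[1]mulr1 ler_pM.
have QP : 1 <= inv_x_sum * P.
  rewrite -(mulVf (lt0r_neq0 x0)).
  by rewrite ler_pM ?invr_ge0 ?inv_x_sum_ge ?(ltW x0).
rewrite sE -mulrA ler_wpM2l ?exprn_ge0 //.
have : (b |*| b) * 1 <= (b |*| b) * (inv_x_sum * P) by rewrite ler_wpM2l // ltW.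
have : 0 <= (1 + error_slope) * P.
  by rewrite mulr_ge0 ?(ltW P0) // addr_ge0 ?error_slope_ge0.
by lra.
Qed.

Let s_gtP : 10 ^+ 6 * P <= s * P.
Proof.
rewrite ler_wpM2r ?(ltW P0) //; apply: le_trans s_ge.
by rewrite mulrDr mulr1 lerDl mulr_ge0 ?exprn_ge0 ?error_slope_ge0.
Qed.

(** Nonnegative coordinates force [mu <= 12], and [mu >= 1] bounds them by [11 * K l]. Hence
    [V.V <= 2 * 11^2 * P], and the gap up to [288 = 2 * 12^2] holds [Delta]. *)
Lemma absorb_forward : (forall l, 0 <= delta_mx 0 l |*| V) ->
  V |*| V / mu + Delta <= 288 * P.
Proof.
move=> V0.
have mu12 : mu <= 12.
  have := le_trans (V0 i) (Vle i).
  by rewrite pmulr_lge0 ?subr_ge0 // (lt_le_trans ltr01).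
have V11 l : delta_mx 0 l |*| V <= 11 * K l.
  apply: le_trans (Vle l) _; rewrite ler_wpM2r ?(le_trans ler01) //.
  by move: mu1; lra.
have L242 : V |*| V <= 242 * P.
  apply: le_trans (bilin_le_xpair hG _ ik) _.
  have : (delta_mx 0 i |*| V) * (delta_mx 0 k |*| V) <= (11 * K i) * (11 * K k).
    by rewrite ler_pM.
  by rewrite -(ler_pM2l x0) /P; lra.
have WE : V |*| b = \sum_l b 0 l * (delta_mx 0 l |*| V).
  by rewrite (bilinC symC) (bilin_coord hG).
have W0 : 0 <= V |*| b by rewrite WE sumr_ge0 // => l _; rewrite mulr_ge0.
have W11 : V |*| b <= 11 * (b |*| b).
  rewrite WE [b |*| b](bilin_b hG) mulr_sumr ler_sum // => l _.
  by rewrite mulrCA ler_wpM2l.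
rewrite -(ler_pM2l s_gt0) mulrDr.
move: DeltaP; rewrite norm_div (ger0_norm W0).
have muB : mu * (b |*| b) <= 12 * (b |*| b) by rewrite ler_wpM2r // ltW.
have [L0|L0] := leP 0 (V |*| V).
  rewrite ger0_norm //.
  have t1 : V |*| V / mu <= 242 * P.
    by apply: le_trans L242; rewrite ler_pdivrMr // ler_peMr.
  have : s * (V |*| V / mu) <= s * (242 * P) by rewrite ler_wpM2l // ltW.
  by move: sP s_gtP P0 B0; lra.
rewrite ltr0_norm //.
have t0 : 0 <= - (V |*| V) / mu by rewrite divr_ge0 ?oppr_ge0 // ltW.
have : 10 ^+ 6 * (- (V |*| V) / mu) <= s * (- (V |*| V) / mu).
  rewrite ler_wpM2r //; apply: le_trans s_ge.
  by rewrite mulrDr mulr1 lerDl mulr_ge0 ?exprn_ge0 ?error_slope_ge0.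
by move: sP s_gtP P0 B0 t0; rewrite !mulNr; lra.
Qed.

(* A negative coordinate together with a coordinate at least 1 makes [V] so
   space-like that its negative square dominates the linear error terms. *)
Lemma absorb_spacelike m n : delta_mx 0 m |*| V < 0 -> 1 <= delta_mx 0 n |*| V ->
  V |*| V / mu + Delta <= 288 * P.
Proof.
move=> m0 n1.
(* For the pair [(l, n)], [V.V <= 2 x V_l V_n <= 2 x V_l] because [V_l < 0] and [V_n >= 1]. *)
have neg l : delta_mx 0 l |*| V < 0 ->
    - (delta_mx 0 l |*| V) <= - (V |*| V) * inv_x_sum / 2 /\ V |*| V < 0.
  move=> l0.
  have ln : l != n by apply: contraTneq l0 => ->; rewrite -leNgt (le_trans ler01).
  have [xl _] := adm_x hG ln.
  have h : V |*| V <= 2 * xpair R G l n * (delta_mx 0 l |*| V).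
    apply: le_trans (bilin_le_xpair hG _ ln) _.
    by rewrite ler_neMr // mulr_ge0_le0 ?ltW // mulr_gt0.
  have L0 : V |*| V < 0 by apply: le_lt_trans h _; rewrite pmulr_rlt0 // mulr_gt0.
  split => //.
  apply: (@le_trans _ _ (- (V |*| V) * (xpair R G l n)^-1 / 2)).
    have -> : - (delta_mx 0 l |*| V) =
        - (2 * xpair R G l n * (delta_mx 0 l |*| V)) / xpair R G l n / 2.
      by move: (xpair R G l n) xl => x /lt0r_neq0 xn; field.
    by rewrite ler_wpM2r ?invr_ge0 // ler_wpM2r ?invr_ge0 ?(ltW xl) // lerN2.
  rewrite ler_wpM2r ?invr_ge0 // ler_wpM2l ?oppr_ge0 ?(ltW L0) //.
  exact: inv_x_sum_ge.
have [_ L0] := neg m m0.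
have absV l : `|delta_mx 0 l |*| V| <= 12 * K l + - (V |*| V) * inv_x_sum / 2.
  have q0 : 0 <= - (V |*| V) * inv_x_sum / 2.
    by rewrite divr_ge0 // mulr_ge0 ?inv_x_sum_ge0 ?oppr_ge0 ?ltW.
  have k0 : 0 <= K l := le_trans ler01 (K1 l).
  have [l0|l0] := leP 0 (delta_mx 0 l |*| V).
    rewrite ger0_norm // (le_trans (Vle l)) //.
    have := mulr_ge0 (ltW mu0) k0; lra.
  by rewrite ltr0_norm //; have [] := neg l l0; move: k0; lra.
have W12 : `|V |*| b| <= 12 * (b |*| b) + - (V |*| V) * error_slope.
  rewrite (bilinC symC) (bilin_coord hG) (le_trans (ler_norm_sum _ _ _)) //.
  apply: (@le_trans _ _ (\sum_l b 0 l * (12 * K l + - (V |*| V) * inv_x_sum / 2))).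
    by apply: ler_sum => l _; rewrite normrM ger0_norm // ler_wpM2l.
  have -> c : \sum_l b 0 l * (12 * K l + c) = 12 * (b |*| b) + (\sum_l b 0 l) * c.
    rewrite [b |*| b](bilin_b hG) mulr_sumr mulr_suml -big_split /=.
    by apply: eq_bigr => l _; ring.
  by rewrite /error_slope; lra.
rewrite -(ler_pM2l s_gt0) mulrDr; move: DeltaP; rewrite norm_div ltr0_norm //.
pose t := - (V |*| V) / mu.
have t0 : 0 < t by rewrite divr_gt0 // oppr_gt0.
have LE : - (V |*| V) = mu * t by rewrite /t mulrC divfK // gt_eqF.
have : V |*| V / mu = - t by rewrite /t mulNr opprK.
move: W12; rewrite LE -/t => W12 ->.
have -> : mu * t / mu = t by rewrite mulrAC divff ?mul1r // gt_eqF.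
(* As [mu <= 208], the error contributes at most [8788 * (1/4 + 104 * error_slope)] times [t], less
   than this lower bound for [s * t]. *)
have st : 10 ^+ 6 * (1 + error_slope) * t <= s * t by rewrite ler_wpM2r // ltW.
have et : 0 <= error_slope * t by rewrite mulr_ge0 ?error_slope_ge0 // ltW.
have mt : mu * (error_slope * t) <= 208 * (error_slope * t) by rewrite ler_wpM2r.
have muB : mu * (b |*| b) <= 208 * (b |*| b) by rewrite ler_wpM2r // ltW.
have sP0 : 0 < s * P by rewrite mulr_gt0.
by move: sP B0; lra.
Qed.

End Pair.
End Absorb.

(** The index [i] minimises [K], so [T_i] is the minimum; [k] is any other index. The factor is
    [72 = 12^2 / 2]. *)
Lemma bound_rhs (hp : (2 <= p)%N) : exists i k : 'I_p, i != k /\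
  72 * (xpair R G i k * K i * K k) <= 2^-1 * max_x R G * (min_T R G * max_T R G).
Proof.
pose i : 'I_p := [arg min_(i < Ordinal p0) K i]%O.
have imin l : K i <= K l by rewrite /i; case: arg_minP => // m _; apply.
have [k ki] : exists k : 'I_p, i != k.
  have [i0|i0] := eqVneq (val i) 0%N.
    by exists (Ordinal hp); rewrite -(inj_eq val_inj) /= i0.
  by exists (Ordinal p0); rewrite -(inj_eq val_inj).
exists i, k; split => //.
have K0 l : 0 <= K l := le_trans ler01 (K00_ge1 hG l).
have Tmax l : Tbase R G l <= max_T R G by apply: le_bigmax.
have Tmin : Tbase R G i <= min_T R G.
  by apply: le_bigmin => // l _; rewrite ler_wpM2l.
have xmax : xpair R G i k <= max_x R G.
  exact: (@le_bigmax_cond _ _ _ _ (i, k) (fun ik : 'I_p * 'I_p => ik.1 != ik.2)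
    (fun ik => xpair R G ik.1 ik.2)).
have x0 : 0 <= xpair R G i k by rewrite ltW //; have [] := adm_x hG ki.
have h1 : Tbase R G i * Tbase R G k <= min_T R G * max_T R G.
  by rewrite ler_pM // mulr_ge0.
have h2 : xpair R G i k * (Tbase R G i * Tbase R G k)
    <= max_x R G * (min_T R G * max_T R G).
  by rewrite ler_pM // !mulr_ge0.
by move: h2; rewrite /Tbase; lra.
Qed.

End Assembly.

Theorem theorem4 (R : realType) (p : nat) (hp : (2 <= p)%N)
    (G : geometry p) (hG : admissible R G) :
  exists jstar : R, forall cfg : configuration R p,
    supersymmetric G cfg ->
    (forall I : 'I_p.+1, jstar <= kahler cfg 0 I) ->
    (nD5 cfg ord0)%:R <=
      2^-1 * max_x R G * (min_T R G * max_T R G) + T0 R G.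
Proof.
have p0 : (0 < p)%N by exact: ltnW.
pose B := bilin (Cmat R G) (bvec R G) (bvec R G).
have [s sE] : exists s, s = 10 ^+ 6 * (1 + error_slope R G + B * inv_x_sum R G).
  by exists (10 ^+ 6 * (1 + error_slope R G + B * inv_x_sum R G)).
have B0 : 0 < B := bb_gt0 hG p0.
have s1 : 10 ^+ 6 <= s.
  rewrite sE ler_peMr ?exprn_ge0 // -addrA lerDl.
  by rewrite addr_ge0 ?error_slope_ge0 // mulr_ge0 ?inv_x_sum_ge0 // ltW.
have [js [js1 large]] := large_radius hG p0 (le_trans (exprn_ge0 6 (ler0n R 10)) s1).
exists js => cfg hS jjs.
have [||l1 l2 l3 l4 l5] := large (kahler cfg 0 0) (tail (kahler cfg)).
- exact: jjs.
- by move=> i; rewrite mxE.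
have [i [k [ik rhs]]] := bound_rhs hG p0 hp.
have j01 := le_trans js1 (jjs 0).
rewrite -lerBlDr; apply: le_trans rhs.
have [/existsP[al0 c0]|/existsPn nc] :=
    boolP [exists al : 'I_(nstacks cfg), flux al 0 0 != 0]; last first.
  apply: le_trans (tadpole0_neutral hG p0 hS s1 j01 l1 l5 nc) _.
  have [x0 _] := adm_x hG ik.
  have K0 l : 0 <= K00 R G l := le_trans ler01 (K00_ge1 hG l).
  exact: mulr_ge0 (ler0n _ 72) (mulr_ge0 (mulr_ge0 (ltW x0) (K0 i)) (K0 k)).
have [m [D [v [/andP[m1 m208] vK [n n0] main Dle]]]] :=
  charged_summary hG p0 hS s1 j01 l1 l2 l3 l4 l5 c0.
(* [288 = 4 * 72], as the summary bounds four times the [D_0]-tadpole. *)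
suff : bilin (Cmat R G) v v / m + D <= 288 * (xpair R G i k * K00 R G i * K00 R G k).
  by move: main; lra.
have vle l := (vK l).2.
have [/forallP v0|] := boolP [forall l, 0 <= bilin (Cmat R G) (delta_mx 0 l) v].
  by have := absorb_forward hG p0 sE m1 vle Dle ik v0; apply.
rewrite negb_forall => /existsP[l]; rewrite -ltNge => vl.
(* Integrality turns a positive coordinate into one that is at least 1. *)
have n1 : 1 <= bilin (Cmat R G) (delta_mx 0 n) v.
  have [/intrP[z nz] _] := vK n.
  by move: n0; rewrite nz ltr0z ler1z gtz0_ge1.
have := absorb_spacelike hG p0 sE m1 m208 vle Dle ik vl n1; exact.
Qed.
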